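(* Let $(B,+,\circ)$ be a two-sided skew brace admitting a generating subset $\emptyset\neq A\subseteq B$ such that $a\circ b=b\circ a$ for all $a,b\in A$. Then the group $(B,\circ)$ is abelian.
   Context: A (left) skew brace is a triple $(B,+,\circ)$ with $(B,+)$ and $(B,\circ)$ groups (not necessarily abelian) such that $a\circ(b+c)=a\circ b-a+a\circ c$ for all $a,b,c\in B$. It is two-sided if moreover $(b+c)\circ a=b\circ a-a+c\circ a$ for all $a,b,c\in B$. A subset $A$ generates $B$ if the only subset of $B$ containing $A$ that is a subgroup of both $(B,+)$ and $(B,\circ)$ is $B$ itself. *)

(* Defs.v *)
From mathcomp Require Import all_boot all_classical.
Set Implicit Arguments. Unset Strict Implicit. Unset Printing Implicit Defensive.

Local Open Scope classical_set_scope.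

(* MathComp allows a single canonical group law per carrier and its additive
   groups are abelian, whereas a skew brace has two, possibly nonabelian and
   infinite, group structures on one type; hence the unbundled predicates. *)

Record is_group (T : Type) (op : T -> T -> T) (e : T) (inv : T -> T) : Prop :=
  IsGroup {
    group_assoc : associative op;
    group_id_l : left_id e op;
    group_id_r : right_id e op;
    group_inv_l : left_inverse e inv op;
    group_inv_r : right_inverse e inv op }.

Record is_subgroup (T : Type) (op : T -> T -> T) (e : T) (inv : T -> T)
    (S : set T) : Prop := IsSubgroup {
  subgroup_id : S e;
  subgroup_op : forall x y, S x -> S y -> S (op x y);
  subgroup_inv : forall x, S x -> S (inv x) }.

Declare Scope brace_scope.
Delimit Scope brace_scope with brace.
Reserved Notation "x ∘ y" (at level 40, left associativity).

(* The two identities zero and one are separate fields: their equality is a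
   consequence of the axioms. *)
Record skewBrace := SkewBrace {
  brace_sort :> Type;
  brace_add : brace_sort -> brace_sort -> brace_sort;
  brace_zero : brace_sort;
  brace_opp : brace_sort -> brace_sort;
  brace_mul : brace_sort -> brace_sort -> brace_sort;
  brace_one : brace_sort;
  brace_inv : brace_sort -> brace_sort;
  brace_add_group : is_group brace_add brace_zero brace_opp;
  brace_mul_group : is_group brace_mul brace_one brace_inv;
  brace_mulDr : forall a b c,
    brace_mul a (brace_add b c) =
    brace_add (brace_add (brace_mul a b) (brace_opp a)) (brace_mul a c) }.

Notation "x + y" := (brace_add x y) : brace_scope.
Notation "x - y" := (brace_add x (brace_opp y)) : brace_scope.
Notation "x ∘ y" := (brace_mul x y) : brace_scope.

Definition two_sided (B : skewBrace) : Prop :=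
  forall a b c : B, ((b + c) ∘ a = b ∘ a - a + c ∘ a)%brace.

Definition brace_generates (B : skewBrace) (A : set B) : Prop :=
  forall S : set B, A `<=` S ->
    is_subgroup (@brace_add B) (@brace_zero B) (@brace_opp B) S ->
    is_subgroup (@brace_mul B) (@brace_one B) (@brace_inv B) S ->
    S = setT.

(* Main.v *)
Require Import Defs.
From mathcomp Require Import all_boot all_classical.

(** In a two-sided skew brace the centralizer of an element in the
    multiplicative group is closed under both group laws, because the two
    distributivity rules have the same shape. The centralizer of each a in A
    contains A, hence is everything; so A lies in the centralizer of every
    element, which is therefore everything as well. *)

Local Open Scope classical_set_scope.

Section GroupCancellation.
Context {T : Type} {op : T -> T -> T} {e : T} {inv : T -> T}.
Hypothesis G : is_group op e inv.

Lemma group_mulKl (x y : T) : op (inv x) (op x y) = y.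
Proof. by rewrite (group_assoc G) (group_inv_l G) (group_id_l G). Qed.

Lemma group_mulVKl (x y : T) : op x (op (inv x) y) = y.
Proof. by rewrite (group_assoc G) (group_inv_r G) (group_id_l G). Qed.

Lemma group_mulKr (x y : T) : op (op y x) (inv x) = y.
Proof. by rewrite -(group_assoc G) (group_inv_r G) (group_id_r G). Qed.

Lemma group_mulIl (x : T) : injective (op x).
Proof. by move=> y z /(congr1 (op (inv x))); rewrite !group_mulKl. Qed.

End GroupCancellation.

Section Centralizer.
Context {B : skewBrace}.
Local Open Scope brace_scope.

Let addG := brace_add_group B.
Let mulG := brace_mul_group B.

(** Distributing [a] over [0 + 0] gives [a ∘ 0 = a ∘ 0 - a + a ∘ 0]; cancelling [a ∘ 0] on the left
    leaves [0 = - a + a ∘ 0]. *)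
Lemma brace_mulr0 (a : B) : a ∘ brace_zero B = a.
Proof.
have := brace_mulDr a (brace_zero B) (brace_zero B).
rewrite (group_id_l addG) -(group_assoc addG) -{1}[a ∘ _](group_id_r addG).
move/(group_mulIl addG)/(congr1 (brace_add a)).
by rewrite (group_mulVKl addG) (group_id_r addG) => <-.
Qed.

(** Evaluate [1 ∘ 0] in two ways. This is what places the additive identity in every multiplicative
    centralizer. *)
Lemma brace_zeroE : brace_zero B = brace_one B.
Proof. by rewrite -[RHS]brace_mulr0 (group_id_l mulG). Qed.

Definition mul_centralizer (a : B) : set B := [set b | a ∘ b = b ∘ a].

Lemma mul_centralizer_mul_subgroup (a : B) :
  is_subgroup (@brace_mul B) (brace_one B) (@brace_inv B) (mul_centralizer a).
Proof.
split; rewrite /mul_centralizer /=.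
- by rewrite (group_id_l mulG) (group_id_r mulG).
- by move=> x y ax ay; rewrite (group_assoc mulG) ax -(group_assoc mulG) ay
    (group_assoc mulG).
- move=> x ax; apply: (group_mulIl mulG x).
  by rewrite (group_assoc mulG) -ax (group_mulKr mulG) (group_mulVKl mulG).
Qed.

Lemma mul_centralizer_add_subgroup (a : B) : two_sided B ->
  is_subgroup (@brace_add B) (brace_zero B) (@brace_opp B) (mul_centralizer a).
Proof.
move=> twoB; split; rewrite /mul_centralizer /=.
- by rewrite brace_zeroE (group_id_l mulG) (group_id_r mulG).
- by move=> x y ax ay; rewrite brace_mulDr twoB ax ay.
(* The added term [a ∘ x - a] completes a distributivity rule on each side: the left becomes
   [a ∘ (x - x)] and, since [a ∘ x = x ∘ a], the right becomes [(x - x) ∘ a]. Both equal [a] because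
   [0 = 1]. *)
- move=> x ax; apply: (group_mulIl addG (a ∘ x - a)).
  rewrite -brace_mulDr ax -twoB (group_inv_r addG) brace_zeroE.
  by rewrite (group_id_l mulG) (group_id_r mulG).
Qed.

End Centralizer.

Theorem proposition6p3 (B : skewBrace) (hB : two_sided B)
    (A : set B) (hA0 : A !=set0) (hA : brace_generates A)
    (hAC : forall a b : B, A a -> A b -> (a ∘ b)%brace = (b ∘ a)%brace) :
  commutative (@brace_mul B).
Proof.
have centralizerT (a : B) : A `<=` mul_centralizer a -> mul_centralizer a = setT.
  move=> sAC; apply: hA => //.
    exact: mul_centralizer_add_subgroup.
  exact: mul_centralizer_mul_subgroup.
have centralA (a b : B) : A a -> mul_centralizer a b.
  by move=> Aa; rewrite centralizerT // => c Ac; exact: hAC.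
move=> x y; suff : mul_centralizer x y by [].
(* Second use of generation, now for an arbitrary [x]: commuting is symmetric, so [x] lying in the
   centralizer of each [a] in [A] puts [A] inside that of [x]. *)
by rewrite centralizerT // => a Aa; apply/esym/centralA.
Qed.
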